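(* For every integer $n\geq 5$, the maximum number of edges in an $n$-vertex graph containing no subgraph isomorphic to $P^2_5$ is $$\mathrm{ex}(n,P^2_5)=\left\lfloor \frac{n^2+n}{4}\right\rfloor .$$
   Context: All graphs are finite, simple and undirected. $P_k$ denotes the path on $k$ vertices $v_1,\dots,v_k$; its square $P^2_k$ is the graph on $v_1,\dots,v_k$ in which $v_i,v_j$ are adjacent iff $1\le |i-j|\le 2$. For a graph $H$, $\mathrm{ex}(n,H)$ is the maximum number of edges in an $n$-vertex graph that does not contain $H$ as a (not necessarily induced) subgraph. *)

(* Defs.v *)
From HB Require Import structures.
From mathcomp Require Import all_boot ssralg ssrint.

Set Implicit Arguments.
Unset Strict Implicit.
Unset Printing Implicit Defensive.

(* A simple graph is given by its edge set, a set of 2-element sets of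
   vertices. *)
Record sgraph (V : finType) := SGraph {
  edges : {set {set V}};
  edges_card2 : [forall e in edges, #|e| == 2]
}.

HB.instance Definition _ (V : finType) := [isSub for @edges V].
HB.instance Definition _ (V : finType) := [Finite of sgraph V by <:].

(* Not necessarily induced: edges of H go to edges of G, and non-edges are
   unconstrained. *)
Definition contains_copy (V W : finType) (G : sgraph V) (H : sgraph W) : bool :=
  [exists f : {ffun W -> V},
     injectiveb f && [forall e in edges H, f @: e \in edges G]].

(* Every n-vertex graph is isomorphic to one on 'I_n. If every n-vertex graph
   contains H (only possible when H has no edge), the value is 0. *)
Definition ex (n : nat) (W : finType) (H : sgraph W) : nat :=
  \max_(G : sgraph 'I_n | ~~ contains_copy G H) #|edges G|.

(* Vertex v_i is the ordinal i - 1. *)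
Definition path_square_edges (k : nat) : {set {set 'I_k}} :=
  [set [set i; j] | i : 'I_k, j : 'I_k in [pred j : 'I_k | 1 <= `|i - j|%N <= 2]].

Lemma path_square_edges_card2 (k : nat) :
  [forall e in path_square_edges k, #|e| == 2].
Proof.
apply/forall_inP => e /imset2P[i j _]; rewrite inE => /andP[dist_gt0 _] ->.
rewrite cards2; case: (eqVneq i j) dist_gt0 => // ->.
by rewrite GRing.subrr.
Qed.

Definition path_square (k : nat) : sgraph 'I_k :=
  SGraph (path_square_edges_card2 k).

(* Main.v *)
(* The upper bound is by induction on the number n of vertices, comparing with
   g(n) = (n^2 + n)/4, which satisfies g(n) - g(n - 4) = 2n - 3.  Let the graph
   contain no square of P_5.  A vertex outside a K_4 has at most one neighbour
   in it, and a vertex outside an induced K_4 minus an edge (a diamond) has at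
   most two neighbours in it; without diamonds, a vertex outside a triangle has
   at most one neighbour in it; without triangles, a vertex outside an edge has
   at most one neighbour in it.  So removing, in this order of preference, a
   K_4, a diamond, a triangle or an edge decreases the number of edges by at
   most the corresponding decrease of g, K_4 itself (where e = 6 > 5 = g(4))
   being the only exception.

   Equality is attained by a complete bipartite graph whose one side has even
   size 2 * floor((n + 2)/4) and carries in addition a perfect matching. *)
Require Import Defs.
From mathcomp Require Import all_boot.
From mathcomp Require Import zify.

Set Implicit Arguments.
Unset Strict Implicit.
Unset Printing Implicit Defensive.

(** * Counting edges by ordered pairs, and peeling off small subgraphs *)

Section EdgeSums.
Variables (V : finType) (r : rel V).
Hypotheses (r_sym : symmetric r) (r_irr : irreflexive r).

(* Counts ordered pairs, so each edge inside A contributes 2 to pair_count A A. *)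
Definition pair_count (A B : {set V}) : nat :=
  \sum_(x in A) \sum_(y in B) (r x y : nat).

Lemma pair_countC A B : pair_count A B = pair_count B A.
Proof.
rewrite /pair_count exchange_big; apply: eq_bigr => y _.
by apply: eq_bigr => x _; rewrite r_sym.
Qed.

Lemma pair_countDl (A B C : {set V}) : [disjoint A & B] ->
  pair_count (A :|: B) C = pair_count A C + pair_count B C.
Proof.
move=> dAB; rewrite /pair_count -bigU //.
by apply: eq_bigl => x; rewrite !inE.
Qed.

(** With [B] the part of [A] outside [s], the pairs split into those within [s], those within [B],
    and the cross pairs, which occur in both orders; hence the factor 2. *)
Lemma pair_count_peel (A : {set V}) (s : seq V) k m :
  uniq s -> {subset s <= A} ->
  \sum_(x <- s) \sum_(y <- s) (r x y : nat) <= k ->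
  {in A, forall v, v \notin s -> \sum_(u <- s) (r u v : nat) <= m} ->
  exists2 B : {set V}, (B \subset A) && (#|B| + size s == #|A|)
    & pair_count A A <= k + 2 * (m * #|B|) + pair_count B B.
Proof.
move=> s_uniq sA le_k le_m; pose S := [set x in s].
have SA : S \subset A by apply/subsetP => x; rewrite inE => /sA.
have cS : #|S| = size s by rewrite cardsE; apply/card_uniqP.
have sumS F : \sum_(x in S) F x = \sum_(x <- s) F x :> nat.
  by rewrite big_uniq //; apply: eq_bigl => x; rewrite inE.
exists (A :\: S).
  by rewrite subsetDl -cS addnC -(cardsID S A) (setIidPr SA) eqxx.
have dj : [disjoint S & A :\: S].
  by rewrite -setI_eq0 setIDA setIC -setIDA setDv setI0.
have eA : A = S :|: (A :\: S) by rewrite -{1}(setID A S) (setIidPr SA).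
have dSS : pair_count S S <= k.
  by rewrite /pair_count sumS; under eq_bigr do rewrite sumS.
have dBS : pair_count (A :\: S) S <= m * #|A :\: S|.
  rewrite mulnC -sum_nat_const; apply: leq_sum => v; rewrite !inE => /andP[vS vA].
  by rewrite sumS; under eq_bigr do rewrite r_sym; apply: le_m.
rewrite {1 2}eA pair_countDl // ![pair_count _ (_ :|: _)]pair_countC.
rewrite !pair_countDl // [pair_count S (A :\: S)]pair_countC; lia.
Qed.

(* The hypotheses on k and m are those making the counts at B and A differ by at
   most (|A|^2 + |A| - |B|^2 - |B|) / 2, whatever |B| is. *)
Lemma pair_count_peel_le (A : {set V}) (s : seq V) k m :
  2 * k <= size s ^ 2 + size s -> 2 * m <= size s ->
  uniq s -> {subset s <= A} ->
  \sum_(x <- s) \sum_(y <- s) (r x y : nat) <= k ->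
  {in A, forall v, v \notin s -> \sum_(u <- s) (r u v : nat) <= m} ->
  (forall B : {set V}, B \subset A -> #|B| + size s = #|A| ->
     2 * pair_count B B <= #|B| ^ 2 + #|B|) ->
  2 * pair_count A A <= #|A| ^ 2 + #|A|.
Proof.
move=> le2k le2m s_uniq sA le_k le_m IH.
have [B /andP[BA /eqP cB] le_A] := pair_count_peel s_uniq sA le_k le_m.
have le_B := IH B BA cB.
have le_mB : 2 * m * #|B| <= size s * #|B| by rewrite leq_mul2r le2m orbT.
clear -le_A le_B le_mB le2k cB; rewrite -cB sqrnD; lia.
Qed.

(** The letters follow the order of the path. The three inequalities concern exactly the pairs at
    distance above 2; the other pairs are adjacent, hence distinct by irreflexivity. *)
Definition path_square5_free := forall a b c d e : V,
  a != d -> a != e -> b != e ->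
  r a b -> r a c -> r b c -> r b d -> r c d -> r c e -> r d e -> False.

Definition has_clique4 (A : {set V}) :=
  [exists a in A, exists b in A, exists c in A, exists d in A,
    [&& r a b, r a c, r a d, r b c, r b d & r c d]].

(** The edge [a b] is shared by both triangles. [c] and [d] may be adjacent, so the diamond is
    induced only once K_4 is excluded. *)
Definition has_diamond (A : {set V}) :=
  [exists a in A, exists b in A, exists c in A, exists d in A,
    [&& r a b, r a c, r a d, r b c, r b d & c != d]].

Definition has_triangle (A : {set V}) :=
  [exists a in A, exists b in A, exists c in A, [&& r a b, r a c & r b c]].

Lemma has_clique4I (A : {set V}) a b c d :
  a \in A -> b \in A -> c \in A -> d \in A ->
  r a b -> r a c -> r a d -> r b c -> r b d -> r c d -> has_clique4 A.
Proof.
move=> aA bA cA dA *; apply/exists_inP; exists a => //.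
apply/exists_inP; exists b => //; apply/exists_inP; exists c => //.
by apply/exists_inP; exists d => //; apply/and5P; split=> //; apply/andP.
Qed.

Lemma has_diamondI (A : {set V}) a b c d :
  a \in A -> b \in A -> c \in A -> d \in A ->
  r a b -> r a c -> r a d -> r b c -> r b d -> c != d -> has_diamond A.
Proof.
move=> aA bA cA dA *; apply/exists_inP; exists a => //.
apply/exists_inP; exists b => //; apply/exists_inP; exists c => //.
by apply/exists_inP; exists d => //; apply/and5P; split=> //; apply/andP.
Qed.

Lemma has_triangleI (A : {set V}) a b c :
  a \in A -> b \in A -> c \in A -> r a b -> r a c -> r b c -> has_triangle A.
Proof.
move=> aA bA cA *; apply/exists_inP; exists a => //.
apply/exists_inP; exists b => //; apply/exists_inP; exists c => //.
exact/and3P.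
Qed.

Lemma has_clique4S (A B : {set V}) :
  B \subset A -> has_clique4 B -> has_clique4 A.
Proof.
move=> /subsetP BA /exists_inP[a /BA aA /exists_inP[b /BA bA]].
move=> /exists_inP[c /BA cA /exists_inP[d /BA dA /and5P[? ? ? ? /andP[? ?]]]].
exact: (@has_clique4I A a b c d).
Qed.

Lemma rel_neq x y : r x y -> x != y.
Proof. by apply: contraTneq => ->; rewrite r_irr. Qed.

Lemma pair_count_le_sqr (A : {set V}) : pair_count A A <= #|A| * #|A|.-1.
Proof.
rewrite -sum_nat_const; apply: leq_sum => x xA.
rewrite (bigD1 x) //= r_irr add0n (cardsD1 x) xA /= -sum1_card.
rewrite [leqRHS](eq_bigl (fun y => (y \in A) && (y != x))); last first.
  by move=> y; rewrite !inE andbC.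
by apply: leq_sum => y _; case: r.
Qed.

(** * The upper bound *)

Hypothesis free : path_square5_free.

Lemma pair_count_clique4_free (A : {set V}) :
  ~~ has_clique4 A -> 2 * pair_count A A <= #|A| ^ 2 + #|A|.
Proof.
have [n] := ubnP #|A|; elim: n A => // n IHn A; rewrite ltnS => leAn noK4.
have IH p (B : {set V}) : B \subset A -> #|B| + p.+1 = #|A| ->
    2 * pair_count B B <= #|B| ^ 2 + #|B|.
  move=> BA cB; apply: IHn; last exact: contra (has_clique4S BA) noK4.
  by apply: leq_trans leAn; rewrite -cB addnS ltnS leq_addr.
have [|noD] := boolP (has_diamond A).
  move=> /exists_inP[a aA /exists_inP[b bA /exists_inP[c cA /exists_inP[d dA]]]].
  move=> /and5P[ab ac ad bc /andP[bd cd]].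
  have [ba ca da cb db] : [/\ r b a, r c a, r d a, r c b & r d b].
    by split; rewrite r_sym.
  have ncd : r c d = false.
    by apply: contraNF noK4 => rcd; apply: (@has_clique4I A a b c d).
  have ndc : r d c = false by rewrite r_sym.
  (* Five edges give 10 ordered pairs, just within [2 * 10 <= 4 ^ 2 + 4]; the 12 pairs of a K_4
     would not fit. *)
  apply: (@pair_count_peel_le A [:: a; b; c; d] 10 2) => //; last exact: IH.
  - by rewrite /= !inE !negb_or cd !rel_neq.
  - by move=> x; rewrite !inE => /or4P[] /eqP->.
  - by rewrite !big_cons !big_nil !r_irr ab ac ad bc bd ncd ba ca da cb db ndc.
  - move=> v vA; rewrite !inE !negb_or !(eq_sym v) => /and4P[va vb vc vd].
    rewrite !big_cons !big_nil.
    have dc : d != c by rewrite eq_sym.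
    (* Among any three neighbours of [v], one is in {a, b} and one in {c, d}; such a pair already
       creates a square of P_5 ending in [v]. *)
    have [av|_] := boolP (r a v); have [bv|_] := boolP (r b v);
    have [cv|_] := boolP (r c v); have [dv|_] := boolP (r d v) => //; exfalso;
    do [ exact: (@free d b a c v) | exact: (@free c b a d v)
       | exact: (@free d a b c v) | exact: (@free c a b d v) ].
have [|noT] := boolP (has_triangle A).
  move=> /exists_inP[a aA /exists_inP[b bA /exists_inP[c cA]]].
  move=> /and3P[ab ac bc].
  have [ba ca cb] : [/\ r b a, r c a & r c b].
    by split; rewrite r_sym.
  apply: (@pair_count_peel_le A [:: a; b; c] 6 1) => //; last exact: IH.
  - by rewrite /= !inE !negb_or !rel_neq.
  - by move=> x; rewrite !inE => /or3P[] /eqP->.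
  - by rewrite !big_cons !big_nil !r_irr ab ac bc ba ca cb.
  - move=> v vA; rewrite !inE !negb_or !(eq_sym v) => /and3P[va vb vc].
    rewrite !big_cons !big_nil.
    have [av|_] := boolP (r a v); have [bv|_] := boolP (r b v);
    have [cv|_] := boolP (r c v) => //; exfalso; move/negP: noD; apply;
    do [ exact: (@has_diamondI A a b c v) | exact: (@has_diamondI A a c b v)
       | exact: (@has_diamondI A b c a v) ].
have [|noE] := boolP [exists a in A, exists b in A, r a b].
  move=> /exists_inP[a aA /exists_inP[b bA ab]].
  have ba : r b a by rewrite r_sym.
  apply: (@pair_count_peel_le A [:: a; b] 2 1) => //; last exact: IH.
  - by rewrite /= !inE !rel_neq.
  - by move=> x; rewrite !inE => /orP[] /eqP->.
  - by rewrite !big_cons !big_nil !r_irr ab ba.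
  - move=> v vA _; rewrite !big_cons !big_nil.
    have [av|_] := boolP (r a v); have [bv|_] := boolP (r b v) => //.
    by move/negP: noT; case; apply: (@has_triangleI A a b v).
rewrite /pair_count big1 // => x xA; rewrite big1 // => y yA.
by apply/eqP; rewrite eqb0; apply: contra noE => xy; apply/exists_inP;
  exists x => //; apply/exists_inP; exists y.
Qed.

(** Peeling a K_4 adds at most [12 + 2 * #|B|] pairs. Twice this is within the allowed
    [8 * #|B| + 20] as soon as [B] is nonempty, which [#|A| != 4] ensures. *)
Lemma pair_count_free (A : {set V}) :
  #|A| != 4 -> 2 * pair_count A A <= #|A| ^ 2 + #|A|.
Proof.
have [n] := ubnP #|A|; elim: n A => // n IHn A; rewrite ltnS => leAn A4.
have [|noK4] := boolP (has_clique4 A); last exact: pair_count_clique4_free.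
move=> /exists_inP[a aA /exists_inP[b bA /exists_inP[c cA /exists_inP[d dA]]]].
move=> /and5P[ab ac ad bc /andP[bd cd]].
have [ba ca da cb [db dc]] : [/\ r b a, r c a, r d a, r c b & r d b /\ r d c].
  by do 2?split; rewrite r_sym.
have [||||B /andP[BA /eqP cB] le] := @pair_count_peel A [:: a; b; c; d] 12 1.
- by rewrite /= !inE !negb_or !rel_neq.
- by move=> x; rewrite !inE => /or4P[] /eqP->.
- by rewrite !big_cons !big_nil !r_irr ab ac ad bc bd cd ba ca da cb db dc.
- move=> v vA; rewrite !inE !negb_or => /and4P[va vb vc vd].
  rewrite !big_cons !big_nil ![r _ v]r_sym.
  have [nad nac nbd ncb] : [/\ a != d, a != c, b != d & c != b].
    by rewrite !rel_neq.
  have nbc : b != c by rewrite eq_sym.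
  (* Two neighbours of [v] would give a square of P_5: [v], these two, then the other two vertices
     of the K_4. *)
  have [av|_] := boolP (r v a); have [bv|_] := boolP (r v b);
  have [cv|_] := boolP (r v c); have [dv|_] := boolP (r v d) => //; exfalso;
  do [ exact: (@free v a b c d) | exact: (@free v a c b d)
     | exact: (@free v a d b c) | exact: (@free v b c a d)
     | exact: (@free v b d a c) | exact: (@free v c d a b) ].
have := pair_count_le_sqr B.
have := IHn B; clear -cB le leAn A4.
rewrite -cB /= in leAn A4 le * => IHB leB; rewrite sqrnD.
(* Induction does not cover a remainder of four vertices, but its trivial bound 12 suffices: 2 * (12
   + 8 + 12) = 64 <= 72. *)
have [B4|B4] := eqVneq #|B| 4; first by rewrite B4 in le leB *; lia.
have := IHB _ B4; lia.
Qed.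

End EdgeSums.

(** * From edge sets to adjacency relations and back *)

Section Graphs.
Variable V : finType.
Implicit Types G : sgraph V.

Definition adj G : rel V := fun x y => [set x; y] \in edges G.

Lemma adj_sym G : symmetric (adj G).
Proof. by move=> x y; rewrite /adj setUC. Qed.

Lemma edge_card2 G e : e \in edges G -> #|e| = 2.
Proof. by move/(forall_inP (edges_card2 G))/eqP. Qed.

Lemma adj_irr G : irreflexive (adj G).
Proof. by move=> x; apply/negP => /edge_card2; rewrite setUid cards1. Qed.

(** Sending [y] to [[set x; y]] is a bijection from the neighbours of [x] to the edges at [x]. *)
Lemma degree_card G x :
  \sum_(y in setT) (adj G x y : nat) = #|[set e in edges G | x \in e]|.
Proof.
have inj : {in [set y | adj G x y] &, injective (fun y => [set x; y])}.
  move=> y z; rewrite !inE => /(rel_neq (@adj_irr G)) xy _ eyz.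
  have: y \in [set x; z] by rewrite -eyz !inE eqxx orbT.
  by rewrite !inE eq_sym (negbTE xy) => /eqP.
have -> : [set e in edges G | x \in e] =
    (fun y => [set x; y]) @: [set y | adj G x y].
  apply/setP => e; rewrite inE; apply/andP/imsetP => [[eG xe]|[y]]; last first.
    by rewrite inE => xy ->; rewrite !inE eqxx.
  have /eqP/cards2P[u [v [_ euv]]] := edge_card2 eG.
  have [y exy] : exists y, e = [set x; y].
    move: xe; rewrite {1}euv !inE => /orP[]/eqP->; first by exists v.
    by exists u; rewrite setUC.
  by exists y; rewrite // inE /adj -exy.
rewrite card_in_imset // -sum1dep_card [RHS]big_mkcond /=.
by apply: eq_big => [y|y _]; rewrite ?inE //; case: adj.
Qed.

Lemma handshake G : pair_count (adj G) setT setT = 2 * #|edges G|.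
Proof.
rewrite /pair_count; under eq_bigr do rewrite degree_card -sum1dep_card.
rewrite mulnC -sum_nat_const.
under [RHS]eq_bigr => e eG do rewrite -(edge_card2 eG) -sum1_card.
rewrite [RHS](exchange_big_dep xpredT) //=.
by apply: eq_big => [x|x _]; rewrite ?inE.
Qed.

Section OfRel.
Variables (r : rel V) (r_sym : symmetric r) (r_irr : irreflexive r).

Definition rel_edges := [set [set p.1; p.2] | p : V * V & r p.1 p.2].

Lemma rel_edges_card2 : [forall e in rel_edges, #|e| == 2].
Proof.
apply/forall_inP => e /imsetP[[x y]]; rewrite inE /= => xy ->.
by rewrite cards2 (rel_neq r_irr xy).
Qed.

Definition rel_graph := SGraph rel_edges_card2.

Lemma adj_rel_graph : adj rel_graph =2 r.
Proof.
move=> x y; apply/imsetP/idP => [[[u v]]|xy]; last by exists (x, y); rewrite ?inE.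
rewrite inE /= => uv e.
(* A singleton [[set x; y]] cannot equal [[set u; v]], since [r u v] makes [u] and [v] distinct. *)
have: x != y.
  apply: contraTneq uv => exy; have := congr1 (fun A : {set V} => #|A|) e.
  by rewrite exy setUid cards1 cards2; case: eqP => // -> _; rewrite r_irr.
have: (x \in [set u; v]) && (y \in [set u; v]) by rewrite -e !inE !eqxx orbT.
rewrite !inE => /andP[/orP[]/eqP-> /orP[]/eqP->]; rewrite ?eqxx //.
by rewrite r_sym.
Qed.
End OfRel.

Lemma contains_path_squareP G k :
  reflect (exists2 f : 'I_k -> V, injective f &
             forall i j : 'I_k, i < j <= i.+2 -> adj G (f i) (f j))
          (contains_copy G (path_square k)).
Proof.
apply: (iffP existsP) => [[f /andP[/injectiveP f_inj /forall_inP fE]]|[f f_inj fE]].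
  exists f => // i j ij; rewrite /adj -imset_set1 -(imset_set1 f j) -imsetU.
  apply: fE; apply/imset2P; exists i j; rewrite // inE; lia.
exists (finfun f); apply/andP; split.
  by apply/injectiveP => i j; rewrite !ffunE; apply: f_inj.
apply/forall_inP => _ /imset2P[i j _ ij ->].
rewrite imsetU !imset_set1 !ffunE -/(adj G (f i) (f j)).
have [lt_ij|le_ji] := ltnP i j; first by apply: fE; move: ij; rewrite inE; lia.
by rewrite adj_sym; apply: fE; move: ij; rewrite inE; lia.
Qed.

Lemma path_square5_freeP G :
  ~~ contains_copy G (path_square 5) -> path_square5_free (adj G).
Proof.
move=> noP a b c d e ad ae be ab ac bc bd cd ce de.
move/negP: noP; apply; apply/contains_path_squareP.
have neq := rel_neq (@adj_irr G).
have t_uniq : uniq [:: a; b; c; d; e].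
  by rewrite /= !inE !negb_or ad ae be !neq.
exists (fun i : 'I_5 => nth a [:: a; b; c; d; e] i).
  by move=> i j /eqP; rewrite nth_uniq // => /eqP/val_inj.
by case=> [[|[|[|[|[|//]]]]] ?] [[|[|[|[|[|//]]]]] ?].
Qed.

End Graphs.

(** * The extremal construction *)

Section Extremal.
Variables (n x : nat).

(* For even x, halving pairs up the vertices below x into a perfect matching. *)
Definition matched_bipartite : rel 'I_n := fun i j =>
  ((i < x) != (j < x)) || [&& i < x, j < x, i != j & i./2 == j./2].

Lemma matched_bipartite_sym : symmetric matched_bipartite.
Proof.
move=> i j; rewrite /matched_bipartite eq_sym (eq_sym i) (eq_sym i./2).
by rewrite andbCA.
Qed.

Lemma matched_bipartite_irr : irreflexive matched_bipartite.
Proof. by move=> i; rewrite /matched_bipartite !eqxx /= !andbF. Qed.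

(** Every triangle has exactly one vertex on the independent side. Applied to abc, bcd and cde, this
    gives some vertex two partners in the matching, forcing a = d or b = e. *)
Lemma matched_bipartite_free : path_square5_free matched_bipartite.
Proof.
move=> a b c d e; rewrite /matched_bipartite -!(inj_eq val_inj) /=.
lia.
Qed.

Lemma sum_ord_ltn : x <= n -> \sum_(j < n) (j < x : nat) = x.
Proof.
move=> le_xn; rewrite -[RHS](minn_idPl le_xn); clear le_xn.
by elim: n => [|m IHm]; rewrite ?big_ord0 ?big_ord_recr ?minn0 //= IHm; lia.
Qed.

Lemma sum_ord_leq : \sum_(j < n) (x <= j : nat) = n - x.
Proof.
by elim: n => [|m IHm]; rewrite ?big_ord0 ?big_ord_recr //= IHm; lia.
Qed.

Lemma matched_bipartite_degree (i : 'I_n) : ~~ odd x -> x <= n ->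
  \sum_(j in setT) (matched_bipartite i j : nat) =
    (n - x).+1 * (i < x) + x * (x <= i).
Proof.
move=> x_even le_xn; rewrite (eq_bigl xpredT) => [|j]; last by rewrite inE.
have [lt_ix|le_xi] := ltnP i x.
  (* The matching partner of [i]; it stays below [x] because [x] is even. *)
  pose p := if odd i then i.-1 else i.+1.
  have lt_px : p < x by rewrite /p; case: ifP; lia.
  pose p' : 'I_n := Ordinal (leq_trans lt_px le_xn).
  have adj_i j : matched_bipartite i j = (x <= j) + (j == p') :> nat.
    rewrite /matched_bipartite -!(inj_eq val_inj) /= lt_ix.
    have [lt_jx|le_xj] := ltnP j x; last first.
      by rewrite (gtn_eqF (leq_trans lt_px le_xj)).
    rewrite /= add0n; congr nat_of_bool; rewrite /p; case: ifP; lia.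
  rewrite muln1 muln0 addn0; under eq_bigr do rewrite adj_i.
  rewrite big_split /= sum_ord_leq (bigD1 p') //= eqxx big1 ?addn1 //.
  by move=> j /negPf->.
rewrite muln0 muln1 -[RHS]sum_ord_ltn //; apply: eq_bigr => j _.
by rewrite /matched_bipartite ltnNge le_xi /=; case: (j < x).
Qed.

Lemma matched_bipartite_count : ~~ odd x -> x <= n ->
  pair_count matched_bipartite setT setT = 2 * x * (n - x) + x.
Proof.
move=> x_even le_xn; rewrite /pair_count.
under eq_bigr do rewrite matched_bipartite_degree //.
rewrite (eq_bigl xpredT) => [|j]; last by rewrite inE.
rewrite big_split -!big_distrr /= sum_ord_ltn // sum_ord_leq; lia.
Qed.

End Extremal.

Theorem theorem3 (n : nat) (hn : 5 <= n) :
  ex n (path_square 5) = (n ^ 2 + n) %/ 4.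
Proof.
apply/eqP; rewrite eqn_leq; apply/andP; split.
  apply/bigmax_leqP => G /path_square5_freeP freeG.
  (* [hn] rules out the exceptional size 4. *)
  have := pair_count_free (@adj_sym _ G) (@adj_irr _ G) freeG (A := setT).
  rewrite handshake cardsT card_ord; lia.
(* The even number nearest to (2n + 1)/4, where the edge count x(n - x) + x/2 peaks. *)
pose x := 2 * ((n + 2) %/ 4).
have x_even : ~~ odd x by rewrite /x; lia.
have le_xn : x <= n by rewrite /x; lia.
pose G := rel_graph (@matched_bipartite_irr n x).
have adjG : adj G =2 @matched_bipartite n x.
  exact/adj_rel_graph/matched_bipartite_sym.
have eG : 2 * #|edges G| = 2 * x * (n - x) + x.
  rewrite -handshake -matched_bipartite_count //.
  by apply: eq_bigr => i _; apply: eq_bigr => j _; rewrite adjG.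
have noG : ~~ contains_copy G (path_square 5).
  apply/contains_path_squareP => -[f f_inj fE].
  (* [inord k] has value [k] only for [k < 5], hence the bounds on [j] below. *)
  pose v k := f (inord k).
  have v_adj i j : i < j <= i.+2 -> j < 5 -> matched_bipartite x (v i) (v j).
    by move=> ij j5; rewrite -adjG fE // !inordK //; lia.
  have v_neq i j : i < j -> j < 5 -> v i != v j.
    by move=> ij j5; rewrite (inj_eq f_inj) -val_eqE /= !inordK //; lia.
  by apply: (@matched_bipartite_free _ x (v 0) (v 1) (v 2) (v 3) (v 4));
    rewrite ?v_adj ?v_neq.
apply: leq_trans (leq_bigmax_cond G noG).
have [k [r [lt_r4 en ex]]] : exists k r, [/\ r < 4, n = 4 * k + r + 2 & x = 2 * k.+1].
  by exists ((n - 2) %/ 4), ((n - 2) %% 4); split; rewrite /x; lia.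
have {eG} : 2 * #|edges G| = 2 * (2 * k.+1) * (2 * k + r) + 2 * k.+1.
  by rewrite eG ex en; congr (_ * _ + _); lia.
move: #|edges G| => m em; rewrite en; clear -lt_r4 em.
(* After cancelling the terms in [k], the claim is that 2r + 1 is at least the floor of (r + 2)(r +
   3)/4, which holds with equality for r < 4. *)
by case: r lt_r4 em => [|[|[|[|//]]]] _ em; nia.
Qed.
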